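(* Let $(X,d)$ be a compact metric space and let $f:X\to X$ be a positively expansive continuous map with the specification property. Then $$h_{top}(f)=\mathcal{E}(f_{\mathcal{K}},\mathcal{K}_f(X)).$$
   Context: $h_{top}(f)$ is topological entropy; $d_n(x,y)=\max_{0\le i\le n-1} d(f^ix,f^iy)$. $\mathcal K(X)$ is the space of nonempty closed subsets of $X$, $f_{\mathcal K}(B)=f(B)$, and $\mathcal K_f(X)=\{B\in\mathcal K(X): f(B)=B\}$. For $A\subset X$, $A^\varepsilon_n=\{x: d_n(x,A)<\varepsilon\}$; $H^n(B,C)=\inf\{\varepsilon>0: B\subset C^\varepsilon_n,\ C\subset B^\varepsilon_n\}$. For nonempty $\mathcal Z\subset\mathcal K(X)$, $N_{\mathcal K}(\mathcal Z,n,\varepsilon)$ is the smallest cardinality of $\mathcal G\subset\mathcal K(X)$ with every $B\in\mathcal Z$ within $H^n$-distance $\le\varepsilon$ of some element of $\mathcal G$, and $\mathcal E(f_{\mathcal K},\mathcal Z)=\lim_{\varepsilon\to0}\limsup_{n\to\infty}\frac{\log\log N_{\mathcal K}(\mathcal Z,n,\varepsilon)}{n}$ (convention $\log0=0$). $f$ is positively expansive if there is $\rho>0$ such that for distinct $x,y$ there is $n\ge0$ with $d(f^nx,f^ny)>\rho$. $f$ has the specification property if for every $\varepsilon>0$ there is $n_0$ such that for any $x_1,\dots,x_k\in X$ and nonnegative integers $n_1,\dots,n_k$, $s_1,\dots,s_k$ with $s_i\ge n_0$, writing $m_j=\sum_{i=1}^j(n_i+s_i)$, $m_0=0$, there is $p\in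 X$ with $d(f^{m_{j-1}+i}p,f^ix_j)<\varepsilon$ for $0\le i<n_j$, $1\le j\le k$. *)

(* Defs.v *)
From HB Require Import structures.
From mathcomp Require Import all_boot all_order all_algebra.
From mathcomp Require Import all_classical all_reals all_analysis.
From Stdlib Require List.
Set Implicit Arguments. Unset Strict Implicit. Unset Printing Implicit Defensive.
Import Order.TTheory GRing.Theory Num.Theory.
Local Open Scope classical_set_scope.
Local Open Scope ring_scope.

Section Dyn.
Variables (R : realType) (X : Type) (d : X -> X -> R).

Definition is_metric : Prop :=
  [/\ (forall x y, 0 <= d x y),
      (forall x y, d x y = 0 <-> x = y),
      (forall x y, d x y = d y x) &
      (forall x y z, d x z <= d x y + d y z)].

Definition mopen (U : set X) : Prop :=
  forall x, U x -> exists e : R, 0 < e /\ forall y, d x y < e -> U y.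

Definition mclosed (B : set X) : Prop :=
  forall x, (forall e : R, 0 < e -> exists y, B y /\ d x y < e) -> B x.

Definition mcompact : Prop :=
  forall (I : Type) (U : I -> set X),
    (forall i, mopen (U i)) -> (forall x, exists i, U i x) ->
    exists J : set I, finite_set J /\ forall x, exists i, J i /\ U i x.

Definition mcontinuous (f : X -> X) : Prop :=
  forall x (e : R), 0 < e ->
    exists del : R, 0 < del /\ forall y, d x y < del -> d (f x) (f y) < e.

Definition dn (f : X -> X) (n : nat) (x y : X) : R :=
  \big[Num.max/0]_(i < n) d (iter i f x) (iter i f y).

Definition pos_expansive (f : X -> X) : Prop :=
  exists rho : R, 0 < rho /\
    forall x y, x <> y -> exists n : nat, rho < d (iter n f x) (iter n f y).

(* specification property (points indexed 0..k-1; the j-th orbit segment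
   starts at time m_j = sum_{i<j} (n_i + s_i)) *)
Definition specification (f : X -> X) : Prop :=
  forall e : R, 0 < e -> exists n0 : nat,
    forall (k : nat) (x : nat -> X) (nn ss : nat -> nat),
      (forall j, (j < k)%N -> (n0 <= ss j)%N) ->
      exists p : X, forall j, (j < k)%N -> forall i, (i < nn j)%N ->
        d (iter ((\sum_(l < j) (nn l + ss l)) + i)%N f p) (iter i f (x j)) < e.

Definition logc (x : R) : R := if x <= 0 then 0 else ln x.

Definition ent_lim (N : nat -> R -> R) (phi : R -> R) : \bar R :=
  lim ((fun eps : R => limn_esup (fun n : nat => ((phi (N n eps)) / n%:R)%:E))
         @ 0^'+).

Definition spanN (f : X -> X) (n : nat) (eps : R) : R :=
  fine (ereal_inf [set (size s)%:R%:E | s in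
     [set s : seq X | forall x, exists y, List.In y s /\ dn f n x y <= eps]]).

Definition htop (f : X -> X) : \bar R := ent_lim (spanN f) logc.

Definition KX : set (set X) := [set B | B !=set0 /\ mclosed B].
Definition Kf (f : X -> X) : set (set X) := [set B | KX B /\ f @` B = B].

Definition dn_set (f : X -> X) (n : nat) (x : X) (A : set X) : R :=
  inf [set dn f n x a | a in A].
Definition nbhd_n (f : X -> X) (n : nat) (eps : R) (A : set X) : set X :=
  [set x | dn_set f n x A < eps].

Definition Hn (f : X -> X) (n : nat) (B C : set X) : R :=
  inf [set e : R | 0 < e /\ B `<=` nbhd_n f n e C /\ C `<=` nbhd_n f n e B].

Definition NK (f : X -> X) (Z : set (set X)) (n : nat) (eps : R) : R :=
  fine (ereal_inf [set (size G)%:R%:E | G in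
     [set G : seq (set X) | (forall C, List.In C G -> KX C) /\
        forall B, Z B -> exists C, List.In C G /\ Hn f n B C <= eps]]).

Definition hyper_ent (f : X -> X) (Z : set (set X)) : \bar R :=
  ent_lim (NK f Z) (fun t => logc (logc t)).

End Dyn.

(* Main.v *)
Require Import Defs.
From HB Require Import structures.
From mathcomp Require Import all_boot all_order all_algebra.
From mathcomp Require Import all_classical all_reals all_analysis.
From mathcomp Require Import lra zify.
Set Implicit Arguments. Unset Strict Implicit. Unset Printing Implicit Defensive.
Import Order.TTheory GRing.Theory Num.Theory.
Import numFieldNormedType.Exports.
Local Open Scope classical_set_scope.
Local Open Scope ring_scope.

(** Upper bound: if E is (n, e)-spanning, every closed set is within e, for H^n,
    of a subset of E, so at most 2^|E| sets suffice.

    Lower bound: take an (n, 14e)-separated set E. By specification and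
    compactness each y in E is e-shadowed, periodically with period n + s for a
    gap s depending only on e, by a point p_y; let B_y be the omega-limit set of
    p_y, which is closed and invariant and passes e-close to y. A length-n orbit
    segment of p_y is known up to 2e from its phase modulo n + s and from its
    behaviour in one gap, so it is 6e-close to at most (n + s) K elements of E,
    with K independent of n. Hence E contains an independent set I for this
    digraph, of cardinality at least |E| / (2 (n + s) K + 1), and the unions of
    the B_y over the nonempty subsets of I are 2^|I| - 1 invariant closed sets
    no two of which are H^n-close to a common set. The polynomial factor
    disappears in the limit, and letting e go to 0 squeezes both entropies. *)

(** * Limits superior and logarithmic growth *)

(** The limit superior is an infimum of suprema over neighbourhoods of infinity; cutting such a
    neighbourhood down to the indices where the bound holds raises the supremum by at most [e]. *)
Lemma le_limn_esup_near (R : realType) (u v : nat -> \bar R) :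
  (forall e : R, 0 < e -> \forall n \near \oo, (u n <= v n + e%:E)%E) ->
  (limn_esup u <= limn_esup v)%E.
Proof.
move=> uv; apply: le_ereal_inf_tmp => _ [V oV <-].
apply/lee_addgt0Pr => e e0.
apply: (@le_trans _ _ (ereal_sup (u @` (V `&` [set n | (u n <= v n + e%:E)%E])))).
  by apply: ereal_inf_lbound; eexists; last reflexivity; apply: filterI => //; exact: uv.
apply: ge_ereal_sup => _ [n [Vn /= uvn] <-]; apply: (le_trans uvn).
by rewrite leeD2r//; apply: ereal_sup_ubound; exists n.
Qed.

Lemma limn_esup_le (R : realType) (u v : nat -> \bar R) :
  (forall n, (u n <= v n)%E) -> (limn_esup u <= limn_esup v)%E.
Proof.
move=> uv; apply: le_limn_esup_near => e e0; apply: nearW => n.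
by apply: (le_trans (uv n)); rewrite leeDl// lee_fin ltW.
Qed.

Lemma ln_linear_near (R : realType) (A C e : R) : 0 < A -> 0 < e ->
  \forall n \near \oo, C + ln (A * n%:R) <= e * n%:R.
Proof.
(* One half of [e] absorbs [ln n], the other half the constants. *)
move=> A0; have [q ->] : exists q, e = q + q.
  by exists (e / 2); lra.
move=> qq0; have q0 : 0 < q by lra.
near=> n.
have n0 : (0 < n)%N by near: n; exact: nbhs_infty_gt.
have nR0 : (0 : R) < n%:R by rewrite ltr0n.
have nD : (C + ln A - ln q) / q <= n%:R by near: n; exact: nbhs_infty_ger.
have : ln (q * n%:R) < q * n%:R by apply: ln_sublinear; rewrite mulr_gt0.
rewrite !lnM ?posrE// => H.
by move: nD; rewrite ler_pdivrMr//; lra.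
Unshelve. all: by end_near.
Qed.

(** * Independent sets in digraphs of bounded out-degree *)

(** Greedy choice: some vertex also has in-degree at most [D]. Keep it, discard it together with its
    at most [2 * D] neighbours in either direction, and recurse on the rest. *)
Lemma ex_indep_set (T : finType) (e : rel T) (D : nat) (A : {set T}) :
  (forall x, x \in A -> (#|[set y in A | e x y]| <= D)%N) ->
  exists I : {set T}, [/\ I \subset A,
    (forall x y, x \in I -> y \in I -> x != y -> ~~ e x y) &
    (#|A| <= (2 * D + 1) * #|I|)%N].
Proof.
move: {2}#|A|.+1 (ltnSn #|A|) => k; elim: k A => // k IH A Ak outD.
have [->|/set0Pn[x0 x0A]] := eqVneq A finset.set0.
  exists finset.set0; split; rewrite ?finset.sub0set ?cards0 ?muln0//.
  by move=> x y; rewrite inE.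
(* Averaging: the in-degrees have the same sum as the out-degrees. *)
have [y yA yin] : exists2 y, y \in A & (#|[set x in A | e x y]| <= D)%N.
  apply: contrapT => no.
  have big y : y \in A -> (D < #|[set x in A | e x y]|)%N.
    by move=> yA; rewrite ltnNge; apply/negP => h; apply: no; exists y.
  have E : (\sum_(x in A) #|[set y in A | e x y]| =
            \sum_(y in A) #|[set x in A | e x y]|)%N.
    under eq_bigr do rewrite -sum1dep_card big_mkcondr.
    under [RHS]eq_bigr do rewrite -sum1dep_card big_mkcondr.
    exact: exchange_big.
  have le1 : (\sum_(x in A) #|[set y in A | e x y]| <= #|A| * D)%N.
    by rewrite -sum_nat_const; apply: leq_sum.
  have : (#|A| * D.+1 <= \sum_(x in A) #|[set y in A | e x y]|)%N.
    by rewrite E -sum_nat_const; apply: leq_sum.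
  have A0 : (0 < #|A|)%N by apply/card_gt0P; exists x0.
  by move=> /leq_trans/(_ le1); rewrite leq_pmul2l// ltnn.
pose N := y |: ([set x in A | e x y] :|: [set x in A | e y x]).
have yN : y \in N by rewrite !inE eqxx.
have cN : (#|N| <= 2 * D + 1)%N.
  rewrite cardsU1 addnC mul2n -addnn leq_add ?leq_b1//.
  by rewrite (leq_trans (leq_card_setU _ _))// leq_add// outD.
have cA : (#|A| <= #|A :\: N| + #|N|)%N.
  by rewrite -[X in (X <= _)%N](cardsID N A) addnC leq_add2l subset_leq_card// finset.subsetIr.
have [||I [IA Iind Icard]] := IH (A :\: N).
- apply: leq_trans (_ : #|A| <= k)%N => //; apply: proper_card.
  by apply/properP; split; [exact: finset.subsetDl|exists y => //; rewrite inE yN].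
- move=> x; rewrite inE => /andP[_ xA]; apply: leq_trans (outD _ xA).
  by apply: subset_leq_card; apply/fintype.subsetP => z; rewrite !inE -andbA => /and3P[_ -> ->].
have yI : y \notin I by apply/negP => /(fintype.subsetP IA); rewrite inE yN.
have nI x : x \in I -> [/\ x \in A, ~~ e x y & ~~ e y x].
  move=> /(fintype.subsetP IA); rewrite !inE => /andP[+ xA].
  by rewrite xA/= !negb_or => /and3P[].
exists (y |: I); split.
- apply/fintype.subsetP => x; rewrite !inE => /predU1P[->//|/nI[]//].
- move=> x z; rewrite !inE => /predU1P[->|xI] /predU1P[->|zI].
  + by rewrite eqxx.
  + by have [] := nI _ zI.
  + by have [] := nI _ xI.
  + exact: Iind.
- by rewrite cardsU1 yI; lia.
Qed.

(** * Minimal cardinalities and their iterated logarithms *)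

(** Sizes are natural numbers, so the infimum is attained and finite, and [fine] returns a true
    minimal cardinality. *)
Lemma fine_inf_size (R : realType) (T : Type) (P : set (seq T)) : P !=set0 ->
  exists s, [/\ P s, fine (ereal_inf [set (size s)%:R%:E | s in P]) = (size s)%:R :> R
    & forall t, P t -> (size s <= size t)%N].
Proof.
move=> [s0 Ps0].
have ex : exists n, `[< exists2 s, P s & size s = n >].
  by exists (size s0); apply/asboolP; exists s0.
case: (ex_minnP ex) => n /asboolP[s Ps sn] nmin.
have smin t : P t -> (size s <= size t)%N.
  by move=> Pt; rewrite sn; apply: nmin; apply/asboolP; exists t.
exists s; split => //.
suff -> : ereal_inf [set (size s)%:R%:E | s in P] = (size s)%:R%:E :> \bar R by [].
apply/eqP; rewrite eq_le; apply/andP; split.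
  by apply: ereal_inf_lbound; exists s.
by apply: le_ereal_inf_tmp => _ [t Pt <-]; rewrite lee_fin ler_nat smin.
Qed.

Lemma logc_ln (R : realType) (x : R) : 0 < x -> logc x = ln x.
Proof. by move=> x0; rewrite /logc leNgt x0. Qed.

(** Since [ln 2 <= 1], one has [ln N <= s], with no additive constant. For [N] equal to 0 or 1 the
    left side is 0 by the convention in [logc]. *)
Lemma loglog_upper (R : realType) (N s : nat) : (0 < s)%N -> (N <= 2 ^ s)%N ->
  logc (logc (N%:R : R)) <= logc s%:R.
Proof.
move=> s0 Ns.
have sR : (1 : R) <= s%:R by rewrite ler1n.
have ls : 0 <= logc (s%:R : R) by rewrite logc_ln ?ln_ge0// (lt_le_trans _ sR).
case: N Ns => [|[|N]] Ns.
- by rewrite {2}/logc lexx /logc lexx.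
- by rewrite {2}/logc ler10 ln1 /logc lexx.
have N1 : (1 : R) < N.+2%:R by rewrite ltr1n.
have N0 : (0 : R) < N.+2%:R by rewrite (lt_trans _ N1).
have lN : 0 < ln (N.+2%:R : R) by rewrite ln_gt0.
rewrite (logc_ln N0) (logc_ln lN) logc_ln ?(lt_le_trans _ sR)//.
rewrite ler_ln ?posrE ?(lt_le_trans _ sR)//.
have : ln (N.+2%:R : R) <= ln (2 ^+ s).
  by rewrite ler_ln ?posrE ?exprn_gt0// -natrX ler_nat.
move=> /le_trans; apply; rewrite lnXn// -(mulr_natr (ln 2) s) ler_piMl//.
have := @le_ln1Dx R 1; have -> : (1 + 1 : R) = 2 by [].
by apply; lra.
Qed.

(** The hypothesis is what counting the [2 ^ m - 1] nonempty subsets of an [m]-element set yields.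
    For [N >= 2], [2 ^ m <= 2 * N <= N ^ 2], so [m * (ln 2 / 2) <= ln N]; a second logarithm gives
    the constant. *)
Lemma loglog_lower (R : realType) (N m : nat) : (0 < m)%N -> (2 ^ m <= N.+1)%N ->
  ln (m%:R : R) <= logc (logc N%:R) + `|ln (ln 2 / 2)|.
Proof.
move=> m0; case: N => [|[|N]] mN.
- by have := leq_trans (leq_pexp2l (isT : 0 < 2)%N m0) mN.
- have -> : m = 1%N by move: mN; rewrite -[2%N in X in (_ <= X)%N]expn1 leq_exp2l//; lia.
  by rewrite {2}/logc ler10 ln1 /logc lexx add0r.
have mR : (0 : R) < m%:R by rewrite ltr0n.
have l2 : 0 < ln (2 : R) by rewrite ln_gt0// ltr1n.
have N0 : (0 : R) < N.+2%:R by rewrite ltr0n.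
have lN : ln 2 <= ln (N.+2%:R : R) by rewrite ler_ln ?posrE// ler_nat.
have lN0 := lt_le_trans l2 lN.
rewrite (logc_ln N0) (logc_ln lN0).
have : m%:R * (ln 2 / 2) <= ln (N.+2%:R : R).
  have : ln (2 ^+ m : R) <= ln (2 * N.+2%:R).
    rewrite ler_ln ?posrE ?exprn_gt0 ?mulr_gt0// -natrX -natrM ler_nat.
    by apply: leq_trans mN _; lia.
  by rewrite lnXn// lnM ?posrE// -(mulr_natr (ln 2) m); lra.
rewrite -ler_ln ?posrE ?mulr_gt0 ?divr_gt0// lnM ?posrE ?divr_gt0//.
have := ler_norm (- ln (ln 2 / 2 : R)); rewrite normrN; lra.
Qed.

(** * Lists, finite sets and counting by labels *)

Lemma In_map_mem (T : eqType) (U : Type) (g : T -> U) (s : seq T) (u : U) :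
  List.In u (map g s) <-> exists2 x, x \in s & u = g x.
Proof.
elim: s u => [|a s IH] u /=; first by split=> // -[].
split=> [[<-|/IH[x xs ->]]|[x]].
- by exists a; rewrite ?mem_head.
- by exists x; rewrite // in_cons xs orbT.
- by rewrite in_cons => /predU1P[-> ->|xs ->]; [left|right; apply/IH; exists x].
Qed.

Lemma In_nth_ord (T : Type) (x0 : T) (s : seq T) (x : T) :
  List.In x s <-> exists i : 'I_(size s), x = nth x0 s i.
Proof.
elim: s x => [|a s IH] x /=; first by split=> // -[[]].
split=> [[<-|/IH[i ->]]|[[[|i] /= ilt] ->]].
- by exists ord0.
- by exists (lift ord0 i).
- by left.
- by right; apply/IH; exists (Ordinal (ilt : i < size s)%N).
Qed.

Lemma finite_set_list (T : Type) (J : set T) :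
  finite_set J -> exists s : seq T, forall x, J x -> List.In x s.
Proof.
move=> fJ; have /finite_seqP[s Js] : finite_set (J : set {classic T}) by [].
exists s => x; have -> : J x = (x \in s) :> Prop by rewrite Js.
by move=> xs; rewrite -[s](@map_id {classic T}); apply/In_map_mem; exists x.
Qed.

Lemma list_bounded (T : Type) (g : T -> nat) (s : seq T) :
  exists M, forall x, List.In x s -> (g x <= M)%N.
Proof.
elim: s => [|a s [M HM]]; first by exists 0%N.
exists (maxn (g a) M) => x /= [<-|/HM]; first exact: leq_maxl.
by move=> /leq_trans; apply; exact: leq_maxr.
Qed.

Lemma card_le_rel (T U : finType) (A : {set T}) (P : T -> U -> Prop) :
  (forall x, x \in A -> exists u, P x u) ->
  (forall x y u, x \in A -> y \in A -> P x u -> P y u -> x = y) ->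
  (#|A| <= #|U|)%N.
Proof.
move=> PA Pinj.
have [->|/set0Pn[x0 /PA[u0 _]]] := eqVneq A finset.set0; first by rewrite cards0.
have /boolp.choice[g gP] x : exists u, x \in A -> P x u.
  by case: (boolP (x \in A)) => [/PA[u Pu]|_]; [exists u|exists u0].
apply: (@leq_card_in _ _ g) => x y xA yA gxy.
by apply: (Pinj x y (g x)) => //; [exact: gP|rewrite gxy; exact: gP].
Qed.

(** * The metrics [dn] and the Hausdorff distances [Hn] *)

Section Metric.
Variables (R : realType) (X : Type) (d : X -> X -> R) (f : X -> X).
Hypothesis d_metric : is_metric d.

Let d_ge0 x y : 0 <= d x y. Proof. by case: d_metric. Qed.
Let d_sym x y : d x y = d y x. Proof. by case: d_metric. Qed.
Let d_tri y x z : d x z <= d x y + d y z. Proof. by case: d_metric. Qed.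
Let d_xx x : d x x = 0. Proof. by case: d_metric => _ /(_ x x)[_ ->]. Qed.
Let d_eq0 x y : d x y = 0 -> x = y. Proof. by case: d_metric => _ /(_ x y)[+ _]. Qed.

Lemma dn_leP n x y (e : R) : 0 <= e ->
  dn d f n x y <= e <-> forall i, (i < n)%N -> d (iter i f x) (iter i f y) <= e.
Proof.
move=> e0; split=> [/bigmax_leP[_ H] i ni|H]; first exact: (H (Ordinal ni)).
by apply/bigmax_leP; split=> // i _; exact: H.
Qed.

Lemma dn_ltP n x y (e : R) : 0 < e ->
  dn d f n x y < e <-> forall i, (i < n)%N -> d (iter i f x) (iter i f y) < e.
Proof.
move=> e0; split=> [/bigmax_ltP[_ H] i ni|H]; first exact: (H (Ordinal ni)).
by apply/bigmax_ltP; split=> // i _; exact: H.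
Qed.

Lemma dn_ge0 n x y : 0 <= dn d f n x y.
Proof. by rewrite /dn bigmax_idl le_max lexx. Qed.

Lemma dn_sym n x y : dn d f n x y = dn d f n y x.
Proof. by apply: eq_bigr => i _; exact: d_sym. Qed.

Lemma dn_tri n y x z : dn d f n x z <= dn d f n x y + dn d f n y z.
Proof.
apply/dn_leP; first by rewrite addr_ge0 ?dn_ge0.
move=> i ni; apply: (le_trans (d_tri (iter i f y) _ _)).
by rewrite lerD//; apply: (iffLR (dn_leP _ _ _ (dn_ge0 _ _ _))).
Qed.

Lemma dn_set_ltP n x (A : set X) (e : R) : A !=set0 ->
  dn_set d f n x A < e <-> exists2 a, A a & dn d f n x a < e.
Proof.
move=> [a0 Aa0]; split=> [/inf_lt[|_ [a Aa <-] xa]|[a Aa xa]].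
- by exists (dn d f n x a0), a0.
- by exists a.
- apply: le_lt_trans xa; apply: ge_inf; last by exists a.
  by exists 0 => _ [b _ <-]; exact: dn_ge0.
Qed.

Lemma Hn_le n (B C : set X) (e : R) : 0 <= e -> B !=set0 -> C !=set0 ->
  (forall b, B b -> exists2 c, C c & dn d f n b c <= e) ->
  (forall c, C c -> exists2 b, B b & dn d f n c b <= e) ->
  Hn d f n B C <= e.
Proof.
move=> e0 B0 C0 BC CB; apply/ler_addgt0Pr => r r0; apply: ge_inf.
  by exists 0 => x [/ltW].
have eer : e < e + r by rewrite ltrDl.
split; [by rewrite ltr_wpDl|split=> x].
  by move=> /BC[c Cc xc]; apply/dn_set_ltP => //; exists c; rewrite ?(le_lt_trans xc).
by move=> /CB[b Bb xb]; apply/dn_set_ltP => //; exists b; rewrite ?(le_lt_trans xb).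
Qed.

Lemma mclosed_bigU (I : finType) (B : I -> set X) (S : {set I}) :
  (forall i, mclosed d (B i)) -> mclosed d [set x | exists2 i, i \in S & B i x].
Proof.
move=> clB x xlim; apply: contrapT => nx.
(* If [x] is outside the union, each [B i] with [i] in [S] stays at some distance [r i > 0] from
   [x]; the minimum of these radii contradicts adherence. Other indices get the dummy radius 1. *)
have /boolp.choice[r rP] i : exists e : R, 0 < e /\
    (i \in S -> forall y, B i y -> e <= d x y).
  have [iS|_] := boolP (i \in S); last by exists 1.
  apply: contrapT => no; apply: nx; exists i => //; apply: clB => e e0.
  apply: contrapT => no2; apply: no; exists e; split=> // _ y By.
  by rewrite leNgt; apply/negP => xy; apply: no2; exists y.
have [|y [[i iS By]]] := xlim (\big[Order.min/1]_i r i).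
  by apply: lt_bigmin => // i _; case: (rP i).
move=> /lt_le_trans/(_ (bigmin_le _ i _)).
by rewrite ltNge; case: (rP i) => _ /(_ iS y By) ->.
Qed.

Lemma mclosed1 x : mclosed d [set x].
Proof.
move=> y xlim; apply: d_eq0; apply/eqP; rewrite eq_le d_ge0 andbT.
by apply/ler_addgt0Pr => e /xlim[_ [->]] /ltW; rewrite add0r.
Qed.

(** * Consequences of compactness *)

Hypothesis X_compact : mcompact d.

(** Otherwise balls that [u] avoids from some rank on cover the space; beyond all the ranks of a
    finite subcover, [u] would lie in no ball. *)
Lemma ex_cluster (u : nat -> X) :
  exists x, forall e : R, 0 < e -> forall N, exists2 k, (N <= k)%N & d x (u k) < e.
Proof.
apply: contrapT => no.
(* A triple holds a centre, a radius and a rank; triples violating [W] index the empty set, so the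
   cover can run over the whole type. *)
pose W (t : X * R * nat) := 0 < t.1.2 /\ forall k, (t.2 <= k)%N -> t.1.2 <= d t.1.1 (u k).
pose U t := [set y : X | W t /\ d t.1.1 y < t.1.2].
have [|x|J [/finite_set_list[s Js] cov]] := X_compact (U := U).
- move=> [[x e] N] y [/= Wt xy]; exists (e - d x y); split; first by rewrite subr_gt0.
  by move=> z yz; split => //=; apply: (le_lt_trans (d_tri y _ _)); rewrite -ltrBrDl.
- apply: contrapT => nW; apply: no; exists x => e e0 N.
  apply: contrapT => nk; apply: nW; exists (x, e, N); split; last by rewrite /= d_xx.
  split=> // k Nk; rewrite leNgt; apply/negP => xk; apply: nk.
  by exists k.
- have [M HM] := list_bounded snd s.
  have [t [/Js/HM tM [[_ tW]]]] := cov (u M).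
  by rewrite ltNge tW.
Qed.

Lemma dn_bounded (x0 : X) : exists M : R, forall n x y, dn d f n x y <= M.
Proof.
have [|x|J [/finite_set_list[s Js] cov]] := X_compact (U := fun k => [set x | d x0 x < k%:R]).
- move=> k x /= xk; exists (k%:R - d x0 x); split; first by rewrite subr_gt0.
  by move=> y xy; apply: (le_lt_trans (d_tri x _ _)); rewrite -ltrBrDl.
- by exists (Num.truncn (d x0 x)).+1; rewrite /= truncnS_gt.
have [M HM] := list_bounded id s.
have x0M x : d x0 x <= M%:R.
  by have [k [/Js/HM kM /ltW/le_trans]] := cov x; apply; rewrite ler_nat.
exists (M%:R + M%:R) => n x y; apply/dn_leP; first by rewrite addr_ge0.
by move=> i _; apply: (le_trans (d_tri x0 _ _)); rewrite lerD// d_sym.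
Qed.

(** The infimum in [Hn] need not be attained, hence the slack from [e] to [e']. Boundedness of [dn]
    makes it an infimum over a nonempty set of radii, not a default value. *)
Lemma Hn_near n (B C : set X) (e e' : R) : B !=set0 -> C !=set0 ->
  Hn d f n B C <= e -> e < e' ->
  (forall b, B b -> exists2 c, C c & dn d f n b c < e') /\
  (forall c, C c -> exists2 b, B b & dn d f n c b < e').
Proof.
move=> B0 C0 BCe ee'; have [b0 Bb0] := B0; have [c0 Cc0] := C0.
have [M HM] := dn_bounded b0.
have M0 : 0 <= M by apply: le_trans (HM n b0 b0); exact: dn_ge0.
have M1 x y : dn d f n x y < M + 1 by apply: (le_lt_trans (HM n x y)); rewrite ltrDl.
have [|r [r0 [BC CB]] re] := inf_lt _ (le_lt_trans BCe ee').
  exists (M + 1); split; [by rewrite ltr_wpDl|split=> x _; apply/dn_set_ltP => //].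
    by exists c0.
  by exists b0.
split=> x => [/BC|/CB] /dn_set_ltP => /(_ _)[]// y Hy xy; exists y => //.
  exact: lt_trans re.
exact: lt_trans re.
Qed.

(** * Continuity, spanning sets and omega-limit sets *)

Hypothesis f_continuous : mcontinuous d f.

Lemma iter_continuous k : mcontinuous d (iter k f).
Proof.
elim: k => [|k IH] x e e0; first by exists e; split.
have [a [a0 Ha]] := f_continuous (iter k f x) e0.
have [b [b0 Hb]] := IH x a a0.
by exists b; split=> // y /Hb/Ha.
Qed.

Lemma dn_continuous n x (e : R) : 0 < e ->
  exists r : R, 0 < r /\ forall y, d x y < r -> dn d f n x y < e.
Proof.
move=> e0; elim: n => [|n [r [r0 Hr]]].
  by exists 1; split=> // y _; rewrite /dn big_ord0.
have [a [a0 Ha]] := iter_continuous n x e0.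
exists (Num.min r a); split; first by rewrite lt_min r0.
move=> y; rewrite lt_min => /andP[/Hr rxy /Ha axy].
apply/dn_ltP => // i; rewrite ltnS leq_eqVlt => /predU1P[->//|].
by apply: (iffLR (dn_ltP _ _ _ e0)).
Qed.

Lemma ex_spanning n (e : R) : 0 < e ->
  exists s : seq X, forall x, exists y, List.In y s /\ dn d f n x y <= e.
Proof.
move=> e0.
have [|x|J [/finite_set_list[s Js] cov]] := X_compact (U := fun y => [set x | dn d f n x y < e]).
- move=> y x /= xy; have [|r [r0 Hr]] := @dn_continuous n x (e - dn d f n x y).
    by rewrite subr_gt0.
  exists r; split=> // z /Hr xz; apply: (le_lt_trans (dn_tri _ x _ _)).
  by rewrite dn_sym -ltrBrDr.
- by exists x; rewrite /=; apply/dn_ltP => // i _; rewrite d_xx.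
by exists s => x; have [y [/Js ys /ltW]] := cov x; exists y.
Qed.

Definition omega_limit (p : X) : set X :=
  [set q | forall e : R, 0 < e -> forall N, exists2 k, (N <= k)%N & d q (iter k f p) < e].

Lemma omega_limit_Kf p : Kf d f (omega_limit p).
Proof.
split; first split.
- exact: (ex_cluster (fun k => iter k f p)).
- move=> q qlim e e0 N.
  have e20 : 0 < e / 2 by rewrite divr_gt0.
  have [y [oy qy]] := qlim _ e20; have [k Nk yk] := oy _ e20 N.
  by exists k => //; apply: (le_lt_trans (d_tri y _ _)); lra.
apply/seteqP; split=> [_ [q oq <-] e e0 N|q oq].
  have [r [r0 Hr]] := f_continuous q e0; have [k Nk /Hr qk] := oq _ r0 N.
  by exists k.+1; rewrite ?leqW.
(* For [q] to be an image, take visits near [q] at times [k.+1] and a cluster point [z] of the orbit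
   at the preceding times; continuity gives [f z = q]. The threshold [j.+1] forces each visit time
   to be positive. *)
have /boolp.choice[k kP] j : exists k, (j <= k)%N /\ d q (iter k.+1 f p) < j.+1%:R^-1.
  have [|[//|k] jk qk] := oq (j.+1%:R^-1) _ j.+1; first by rewrite invr_gt0.
  by exists k.
have [z Hz] := ex_cluster (fun j => iter (k j) f p).
exists z.
  move=> e e0 N; have [j Nj zj] := Hz _ e0 N.
  by exists (k j) => //; apply: (leq_trans Nj); case: (kP j).
apply: d_eq0; apply/eqP; rewrite eq_le d_ge0 andbT.
suff H (e : R) : 0 < e -> d (f z) q <= e.
  by apply/ler_addgt0Pr => e e0; rewrite add0r H.
move=> e0; have e20 : 0 < e / 2 by rewrite divr_gt0.
have [r [r0 Hr]] := f_continuous z e20.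
have [N _ HN] : \forall n \near \oo, (n.+1%:R^-1 : R) < e / 2 by exact: near_infty_natSinv_lt (PosNum e20).
have [j Nj /Hr zj] := Hz _ r0 N.
have := d_tri (iter (k j).+1 f p) (f z) q; rewrite (d_sym (iter _ f p) q).
have Hj : (j.+1%:R^-1 : R) < e / 2 := HN j Nj.
have [_ /lt_trans/(_ Hj) qj] := kP j.
by move: zj qj => /=; lra.
Qed.

Lemma omega_limit_dn p q n (e : R) : omega_limit p q -> 0 < e ->
  exists k, dn d f n q (iter k f p) < e.
Proof.
move=> oq e0; have [r [r0 Hr]] := dn_continuous n q e0.
by have [k _ /Hr qk] := oq _ r0 0%N; exists k.
Qed.

Lemma Kf_bigU (I : finType) (B : I -> set X) (S : {set I}) :
  (forall i, Kf d f (B i)) -> S != finset.set0 ->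
  Kf d f [set x | exists2 i, i \in S & B i x].
Proof.
move=> KB /set0Pn[i0 i0S]; split; first split.
- by have [[[x Bx] _] _] := KB i0; exists x, i0.
- by apply: mclosed_bigU => i; case: (KB i) => -[].
apply/seteqP; split=> [_ [x [i iS Bx] <-]|x [i iS]].
  by exists i => //; have [_ <-] := KB i; exists x.
by have [_ {1}<-] := KB i => -[y By <-]; exists y => //; exists i.
Qed.

(** The orbit is sampled at the multiples of [m], where the shadowing windows begin; a cluster point
    of these samples inherits the non-strict bound. *)
Lemma omega_limit_dn_cluster p x n m (e : R) : (0 < m)%N ->
  (forall j i, (i < n)%N -> d (iter (j * m + i) f p) (iter i f x) <= e) ->
  0 <= e -> exists2 b, omega_limit p b & dn d f n b x <= e.
Proof.
move=> m0 px e0; have [b Hb] := ex_cluster (fun j => iter (j * m) f p).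
exists b.
  move=> r r0 N; have [j Nj bj] := Hb _ r0 N; exists (j * m)%N => //.
  by apply: (leq_trans Nj); rewrite leq_pmulr.
apply/ler_addgt0Pr => r r0.
have [a [a0 Ha]] := dn_continuous n b r0; have [j _ /Ha bj] := Hb _ a0 0%N.
apply: (le_trans (dn_tri _ (iter (j * m) f p) _ _)); rewrite addrC lerD ?(ltW bj)//.
by apply/dn_leP => // i ni; rewrite -iterD addnC px.
Qed.

(** * Specification and periodic shadowing *)

Hypothesis f_spec : specification d f.

(** Specification repeats the segment of [x] any finite number [k] of times with a constant gap; a
    cluster point of the resulting points, as [k] grows, shadows all repetitions at once. The gap
    comes from the specification constant for [e] alone. *)
Lemma ex_periodic_shadow (e : R) : 0 < e -> exists2 s, (0 < s)%N &
  forall n x, exists p, forall j i, (i < n)%N ->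
    d (iter (j * (n + s) + i) f p) (iter i f x) <= e.
Proof.
move=> e0; have [n0 Hn0] := f_spec e0; exists n0.+1 => // n x.
have /boolp.choice[p pP] k : exists p, forall j, (j < k)%N -> forall i, (i < n)%N ->
    d (iter (j * (n + n0.+1) + i) f p) (iter i f x) < e.
  have [//|p pP] := Hn0 k (fun=> x) (fun=> n) (fun=> n0.+1).
  by exists p => j jk i /(pP j jk); rewrite sum_nat_const card_ord.
have [q Hq] := ex_cluster p; exists q => j i ni; apply/ler_addgt0Pr => r r0.
have [a [a0 Ha]] := @iter_continuous (j * (n + n0.+1) + i)%N q r r0.
(* The rank [j.+1] ensures [j < k], so that [p k] already shadows in the [j]-th window. *)
have [k jk /Ha qk] := Hq _ a0 j.+1.
have := d_tri (iter (j * (n + n0.+1) + i) f (p k)) (iter (j * (n + n0.+1) + i) f q) (iter i f x).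
by have := pP k j jk i ni; lra.
Qed.

(* A point periodically shadowing x is determined up to 2e, along a window of
   n + (n + s) steps, by what it does during one gap of length s. *)
Lemma shadow_window n s (e : R) p x z l l' t : 0 <= e ->
  (forall j i, (i < n)%N -> d (iter (j * (n + s) + i) f p) (iter i f x) <= e) ->
  dn d f s (iter (l * (n + s) + n) f p) z <= e ->
  dn d f s (iter (l' * (n + s) + n) f p) z <= e ->
  (t < n + s + n)%N ->
  d (iter (l * (n + s) + t) f p) (iter (l' * (n + s) + t) f p) <= e + e.
Proof.
move=> e0 px /dn_leP gl /dn_leP gl' tn.
have [tn1|nt] := ltnP t n.
  by apply: (le_trans (d_tri (iter t f x) _ _)); rewrite lerD ?px// d_sym px.
have [ts|st] := ltnP t (n + s).
  have ts' : (t - n < s)%N by lia.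
  have := gl e0 _ ts'; have := gl' e0 _ ts'; rewrite -!iterD.
  have E k : (t - n + (k * (n + s) + n) = k * (n + s) + t)%N by lia.
  rewrite !E => H1 H2; apply: (le_trans (d_tri (iter (t - n) f z) _ _)).
  by rewrite lerD// d_sym.
have E k : (k * (n + s) + t = k.+1 * (n + s) + (t - (n + s)))%N by rewrite mulSn; lia.
rewrite !E; apply: (le_trans (d_tri (iter (t - (n + s)) f x) _ _)).
have tn' : (t - (n + s) < n)%N by lia.
by rewrite lerD ?px// d_sym px.
Qed.

(** Label each [E i] met by the orbit of [p] with the phase of the meeting time modulo [n + s] and
    with a point of [zs] that is [e]-close to the orbit during the gap of that period. No label
    serves two points. *)
Lemma card_shadow_orbit_near n s (e : R) p x (M : nat) (E : 'I_M -> X) (zs : seq X) :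
  0 < e -> (0 < s)%N ->
  (forall j i, (i < n)%N -> d (iter (j * (n + s) + i) f p) (iter i f x) <= e) ->
  (forall y, exists z, List.In z zs /\ dn d f s y z <= e) ->
  (forall i j, i != j -> 14 * e < dn d f n (E i) (E j)) ->
  (#|[set i | `[< exists k, (dn d f n (E i) (iter k f p) < 6 * e)%R >]]%SET| <=
     (n + s) * size zs)%N.
Proof.
move=> e0 s0 px zsP sepE.
have e0' := ltW e0.
set A := finset.finset _.
pose P i (t : 'I_(n + s) * 'I_(size zs)) := exists l,
  dn d f n (E i) (iter (l * (n + s) + t.1) f p) < 6 * e /\
  dn d f s (iter (l * (n + s) + n) f p) (nth x zs t.2) <= e.
rewrite -[X in (_ <= X * _)%N]card_ord -[X in (_ <= _ * X)%N]card_ord -card_prod.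
apply: (@card_le_rel _ _ A P) => [i|i j [t c] _ _ [l [il gl]] [l' [jl' gl']]].
  rewrite inE => /asboolP[k ik].
  have ns0 : (0 < n + s)%N by rewrite addn_gt0 s0 orbT.
  have [z [/(In_nth_ord x)[c ->] zc]] := zsP (iter (k %/ (n + s) * (n + s) + n) f p).
  exists (Ordinal (ltn_pmod k ns0), c), (k %/ (n + s))%N; split=> //=.
  by rewrite -divn_eq.
(* With equal labels, the two orbit stretches are within [2 * e], so [E i] and [E j] are within
   [6 * e + 2 * e + 6 * e]: this is the origin of 14. *)
apply/eqP/negPn/negP => /sepE; apply/negP; rewrite -leNgt.
have mid : dn d f n (iter (l * (n + s) + t) f p) (iter (l' * (n + s) + t) f p) <= e + e.
  apply/dn_leP; first by rewrite addr_ge0.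
  move=> u un; rewrite -!iterD !(addnC u) -!addnA.
  by apply: shadow_window px gl gl' _ => //; have := ltn_ord t; lia.
have := dn_tri n (iter (l * (n + s) + t) f p) (E i) (E j).
have := dn_tri n (iter (l' * (n + s) + t) f p) (iter (l * (n + s) + t) f p) (E j).
by move: il jl' mid => /=; rewrite (dn_sym n (E j)); lra.
Qed.

End Metric.

(** * Spanning numbers and the upper bound *)

Section Entropy.
Variables (R : realType) (X : Type) (d : X -> X -> R) (f : X -> X) (x0 : X).
Hypotheses (d_metric : is_metric d) (X_compact : mcompact d).
Hypothesis f_continuous : mcontinuous d f.

Lemma spanN_min n (e : R) : 0 < e -> exists s : seq X,
  [/\ forall x, exists y, List.In y s /\ dn d f n x y <= e,
      spanN d f n e = (size s)%:R, (0 < size s)%N &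
      forall t : seq X, (forall x, exists y, List.In y t /\ dn d f n x y <= e) ->
        (size s <= size t)%N].
Proof.
move=> e0; have [//|s [sP sE smin]] :=
  @fine_inf_size R X [set s | forall x, exists y, List.In y s /\ dn d f n x y <= e].
  exact: ex_spanning.
by exists s; split=> //; case: s {sE smin} sP => // /(_ x0)[y []].
Qed.

Lemma ex_hyper_spanning n (e : R) (s : seq X) : 0 <= e ->
  (forall x, exists y, List.In y s /\ dn d f n x y <= e) ->
  exists G : seq (set X), [/\ (size G <= 2 ^ size s)%N, forall C, List.In C G -> KX d C &
    forall B, KX d B -> exists C, List.In C G /\ Hn d f n B C <= e].
Proof.
move=> e0 sP.
pose C (A : {set 'I_(size s)}) := [set y | exists2 i, i \in A & [set nth x0 s i] y].
exists [seq C A | A <- enum [pred A | A != finset.set0]]; split.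
- rewrite size_map -cardE (leq_trans (max_card _))//.
  by rewrite (eq_card (B := powerset [set: 'I_(size s)]%SET)) ?card_powerset ?cardsT ?card_ord//
    => A; rewrite !inE finset.subsetT.
- move=> _ /In_map_mem[A + ->]; rewrite mem_enum inE => /set0Pn[i iA].
  split; first by exists (nth x0 s i), i.
  by apply: mclosed_bigU => // j; exact: mclosed1.
move=> B [[b0 Bb0] _].
(* Keeping exactly the spanning points [e]-close to [B] secures both halves of the Hausdorff
   bound. *)
pose A : {set 'I_(size s)} := [set i : 'I_(size s) | `[< exists2 b, B b & dn d f n (nth x0 s i) b <= e >]]%SET.
have near_b b : B b -> exists2 c, C A c & dn d f n b c <= e.
  move=> Bb; have [y [/(In_nth_ord x0)[i ->] bi]] := sP b.
  exists (nth x0 s i) => //; exists i => //.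
  by rewrite inE; apply/asboolP; exists b; rewrite // dn_sym.
exists (C A); have [c0 Cc0 _] := near_b _ Bb0; split.
  apply/In_map_mem; exists A => //; rewrite mem_enum inE.
  by case: Cc0 => i iA _; apply/set0Pn; exists i.
apply: Hn_le => //; first by exists b0.
  by exists c0.
by move=> _ [i + ->]; rewrite inE => /asboolP.
Qed.

Lemma NK_min (Z : set (set X)) n (e : R) : 0 < e -> Z `<=` KX d ->
  exists G : seq (set X),
  [/\ forall C, List.In C G -> KX d C,
      forall B, Z B -> exists C, List.In C G /\ Hn d f n B C <= e,
      NK d f Z n e = (size G)%:R &
      forall s : seq X, (forall x, exists y, List.In y s /\ dn d f n x y <= e) ->
        (size G <= 2 ^ size s)%N].
Proof.
move=> e0 ZK; pose P := [set G : seq (set X) | (forall C, List.In C G -> KX d C) /\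
  forall B, Z B -> exists C, List.In C G /\ Hn d f n B C <= e].
have ex s : (forall x, exists y, List.In y s /\ dn d f n x y <= e) ->
    exists2 G, P G & (size G <= 2 ^ size s)%N.
  move=> /(ex_hyper_spanning (ltW e0))[G [Gs GK GB]]; exists G => //.
  by split=> // B /ZK/GB.
have [s0 /ex[G0 PG0 _]] := ex_spanning d_metric X_compact f_continuous n e0.
have [|G [[GK GZ] GE Gmin]] := @fine_inf_size R _ P; first by exists G0.
exists G; split=> // s /ex[G' PG' /(leq_trans _)]; apply; exact: Gmin.
Qed.

Lemma loglog_NK_le (Z : set (set X)) n (e : R) : 0 < e -> Z `<=` KX d ->
  logc (logc (NK d f Z n e)) <= logc (spanN d f n e).
Proof.
move=> e0 ZK; have [s [sP -> s0 _]] := spanN_min n e0.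
by have [G [_ _ -> /(_ s sP)]] := NK_min n e0 ZK; exact: loglog_upper.
Qed.

(** Greedy choice: fewer points than the spanning number cannot span, so some point is more than [e]
    away from all those chosen so far. *)
Lemma ex_separated n (e : R) k : 0 < e -> k%:R <= spanN d f n e ->
  exists E : nat -> X, forall i j, (i < j < k)%N -> e < dn d f n (E j) (E i).
Proof.
move=> e0; have [s [_ -> _ smin]] := spanN_min n e0.
rewrite ler_nat; elim: k => [|k IH] ks; first by exists (fun=> x0) => i j; rewrite andbF.
have [E EP] := IH (ltnW ks).
have [x xP] : exists x, forall i, (i < k)%N -> e < dn d f n x (E i).
  apply: contrapT => no; move: ks; rewrite ltnNge => /negP; apply.
  rewrite -(size_iota 0 k) -(size_map E); apply: smin => x.
  apply: contrapT => nx; apply: no; exists x => i ik.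
  rewrite ltNge; apply/negP => xi; apply: nx; exists (E i); split=> //.
  by apply/In_map_mem; exists i; rewrite // mem_iota.
exists (fun i => if i == k then x else E i) => i j /andP[ij jk].
have ik : (i < k)%N by lia.
rewrite (ltn_eqF ik); have [_|jNk] := eqVneq j k; first exact: xP.
by apply: EP; lia.
Qed.

(** * The lower bound *)

Hypothesis f_spec : specification d f.

(** [A] and [C] are fixed before [n], so the error [C + ln (A * n)] vanishes after division by
    [n]. *)
Lemma spanN_le_loglog_NK (e : R) : 0 < e -> exists A C : R, 0 < A /\
  forall n, (0 < n)%N ->
    logc (spanN d f n (14 * e)) <= logc (logc (NK d f (Kf d f) n e)) + (C + ln (A * n%:R)).
Proof.
move=> e0; have e0' := ltW e0.
have [s s0 shadow] := ex_periodic_shadow d_metric X_compact f_continuous f_spec e0.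
have [zs zsP] := ex_spanning d_metric X_compact f_continuous s e0.
(* For [n >= 1], [n + s <= n * s.+1], so [A * n] dominates the loss [2 * ((n + s) * size zs) + 1] of
   the independent set. *)
pose A := (2 * (s.+1 * size zs) + 1)%N.
have A0 : (0 : R) < A%:R by rewrite ltr0n /A addn1.
exists A%:R, `|ln (ln 2 / 2)|; split=> // n n0.
have e14 : 0 < 14 * e by rewrite mulr_gt0.
have [sp [_ spE sp0 _]] := spanN_min n e14.
have [|E EP] := @ex_separated n _ (size sp) e14; first by rewrite spE.
have sepE (i j : 'I_(size sp)) : i != j -> 14 * e < dn d f n (E i) (E j).
  rewrite -val_eqE neq_ltn => /orP[ij|ji].
    by rewrite dn_sym// EP// ij/=.
  by rewrite EP// ji/=.
have /boolp.choice[p pP] (y : 'I_(size sp)) := shadow n (E y).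
pose sees (y x : 'I_(size sp)) := `[< exists k, dn d f n (E x) (iter k f (p y)) < 6 * e >].
have [|I [_ Iind Icard]] :=
    @ex_indep_set _ sees ((n + s) * size zs) [set: 'I_(size sp)]%SET.
  move=> y _; apply: leq_trans (card_shadow_orbit_near d_metric e0 s0 (pP y) zsP sepE).
  by apply: subset_leq_card; apply/fintype.subsetP => x; rewrite !inE.
pose B (S : {set 'I_(size sp)}) := [set b | exists2 y, y \in S & omega_limit d f (p y) b].
have KB S : S != finset.set0 -> Kf d f (B S).
  by apply: Kf_bigU => // y; exact: omega_limit_Kf.
have [//|G [GK GZ GE _]] := @NK_min (Kf d f) n e e0; first by move=> ? [].
(* For [x] in [S], go from [E x] to a point of [B S], to [D], to [B S'], and to the orbit of some
   [p y] with [y] in [S']: the steps cost [e], [2 * e], [2 * e] and [e], whence the 6 in [sees].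
   Independence of [I] then forces [y = x]. *)
have sub_of_near (S S' : {set 'I_(size sp)}) D : S \subset I -> S' \subset I -> S != finset.set0 ->
    S' != finset.set0 -> KX d D ->
    Hn d f n (B S) D <= e -> Hn d f n (B S') D <= e -> S \subset S'.
  move=> SI S'I Sn0 S'n0 KD HS HS'.
  have e2 : e < 2 * e by lra.
  have [[BS0 _] _] := KB S Sn0; have [[BS'0 _] _] := KB S' S'n0; case: (KD) => D0 _.
  have [SD _] := Hn_near d_metric X_compact BS0 D0 HS e2.
  have [_ DS'] := Hn_near d_metric X_compact BS'0 D0 HS' e2.
  apply/fintype.subsetP => x xS.
  have [|b ob bx] := omega_limit_dn_cluster d_metric X_compact f_continuous _ (pP x) e0'.
    by rewrite addn_gt0 n0.
  have [|c Dc bc] := SD b; first by exists x.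
  have [b' [y yS' ob'] cb'] := DS' c Dc.
  have [k b'k] := omega_limit_dn f_continuous n ob' e0.
  have yx : sees y x.
    apply/asboolP; exists k.
    have := dn_tri f d_metric n b (E x) (iter k f (p y)).
    have := dn_tri f d_metric n c b (iter k f (p y)).
    have := dn_tri f d_metric n b' c (iter k f (p y)).
    by rewrite (dn_sym f d_metric n (E x) b); lra.
  have [<-//|xy] := eqVneq y x.
  by have := Iind y x (fintype.subsetP S'I _ yS') (fintype.subsetP SI _ xS) xy; rewrite yx.
(* Each nonempty subset of [I] is labelled by a centre in [G] close to its union; the successor
   accounts for the empty subset. *)
have cardG : (2 ^ #|I| <= (size G).+1)%N.
  rewrite -card_powerset (cardsD1 finset.set0) powersetE finset.sub0set add1n ltnS.
  rewrite -[X in (_ <= X)%N]card_ord.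
  apply: (@card_le_rel _ _ _ (fun S (c : 'I_(size G)) => Hn d f n (B S) (nth set0 G c) <= e)).
    move=> S; rewrite !inE => /andP[/KB/GZ[D [/(In_nth_ord set0)[c ->]]] HD _].
    by exists c.
  move=> S S' c; rewrite !inE => /andP[S0 SI] /andP[S'0 S'I] HS HS'.
  have KD : KX d (nth set0 G c) by apply: GK; apply/(In_nth_ord set0); exists c.
  by apply/eqP; rewrite finset.eqEsubset; apply/andP; split; apply: (sub_of_near _ _ _ _ _ _ _ KD).
have spI : (size sp <= A * n * #|I|)%N.
  rewrite cardsT card_ord in Icard; apply: (leq_trans Icard).
  have ns : ((n + s) * size zs <= n * (s.+1 * size zs))%N.
    by rewrite mulnA leq_mul2r; apply/orP; right; nia.
  by rewrite leq_mul2r /A; apply/orP; right; move: ns; set u := (_ * size zs)%N; nia.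
have I0 : (0 < #|I|)%N by move: spI; case: #|I| => //; rewrite muln0; lia.
have := loglog_lower R I0 cardG; rewrite -GE spE (@logc_ln _ (size sp)%:R) ?ltr0n//.
have An0 : (0 : R) < A%:R * n%:R by rewrite mulr_gt0// ltr0n.
have IR0 : (0 : R) < #|I|%:R by rewrite ltr0n.
have : ln (size sp)%:R <= ln (A%:R * n%:R * #|I|%:R : R).
  by rewrite ler_ln ?posrE ?(mulr_gt0 An0)// ?ltr0n// -!natrM ler_nat.
by rewrite lnM ?posrE//; lra.
Qed.

End Entropy.

(** * Passage to the limit and equality of the entropies *)

Theorem theorem1p5 (R : realType) (X : Type) (d : X -> X -> R) (f : X -> X) :
  is_metric d -> mcompact d -> mcontinuous d f ->
  pos_expansive d f -> specification d f ->
  htop d f = hyper_ent d f (Kf d f).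
Proof.
move=> dM Xc fc _ fs.
pose a (e : R) := limn_esup (fun n : nat => ((logc (spanN d f n e)) / n%:R)%:E).
pose b (e : R) := limn_esup (fun n : nat =>
  ((logc (logc (NK d f (Kf d f) n e))) / n%:R)%:E).
(* On the empty space the empty list is admissible for both counts, so both vanish. *)
have [[x0]|noX] := pselect (inhabited X); last first.
  rewrite -[LHS]/(lim (a @ 0^'+)) -[RHS]/(lim (b @ 0^'+)).
  suff -> : a = b by [].
  apply/funext => e; congr limn_esup; apply/funext => n.
  have -> : spanN d f n e = 0.
    rewrite /spanN; have [|s [_ -> /(_ [::])]] := @fine_inf_size R X
      [set s | forall x, exists y, List.In y s /\ dn d f n x y <= e].
      by exists [::] => x; case: noX.
    by rewrite leqn0 => /(_ _)/eqP-> // x; case: noX.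
  have -> : NK d f (Kf d f) n e = 0.
    have noK B : ~ Kf d f B by move=> [[[x]]]; case: noX.
    rewrite /NK; have [|s [_ -> /(_ [::])]] := @fine_inf_size R _ [set G : seq (set X) |
      (forall C, List.In C G -> KX d C) /\
      forall B, Kf d f B -> exists C, List.In C G /\ Hn d f n B C <= e].
      by exists [::]; split=> // B /noK.
    by rewrite leqn0 => /(_ _)/eqP-> //; split=> // B /noK.
  have logc0 : logc (0 : R) = 0 by rewrite /logc lexx.
  by rewrite !logc0.
have a_anti (e e' : R) : 0 < e -> e <= e' -> (a e' <= a e)%E.
  move=> e0 ee'; apply: limn_esup_le => n.
  rewrite lee_fin ler_wpM2r// ?invr_ge0//.
  have [s [sP -> s0 _]] := spanN_min x0 dM Xc fc n e0.
  have [t [_ -> t0 tmin]] := spanN_min x0 dM Xc fc n (lt_le_trans e0 ee').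
  rewrite !logc_ln ?ltr0n// ler_ln ?posrE ?ltr0n// ler_nat.
  by apply: tmin => x; have [y [ys /le_trans xy]] := sP x; exists y; split=> //; exact: xy.
have b_le_a (e : R) : 0 < e -> (b e <= a e)%E.
  move=> e0; apply: limn_esup_le => n; rewrite lee_fin ler_wpM2r// ?invr_ge0//.
  by apply: loglog_NK_le => // B [].
have a_le_b (e : R) : 0 < e -> (a (14 * e)%R <= b e)%E.
  move=> e0; have [A [C [A0 HAC]]] := spanN_le_loglog_NK x0 dM Xc fc fs e0.
  apply: le_limn_esup_near => r r0; near=> n.
  have n0 : (0 < n)%N by near: n; exact: nbhs_infty_gt.
  have nR0 : (0 : R) < n%:R by rewrite ltr0n.
  rewrite -EFinD lee_fin ler_pdivrMr// [leRHS]mulrDl divfK ?gt_eqF//.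
  apply: (le_trans (HAC n n0)); rewrite lerD2l.
  by near: n; exact: ln_linear_near.
(* By monotonicity the limit at [0] is the supremum over all positive radii. *)
have a_cvg : a e @[e --> 0^'+] --> ereal_sup (a @` [set` `]0, +oo[]).
  apply: nonincreasing_at_right_cvge => // e e'; rewrite !in_itv/= !andbT => e0 _.
  exact: a_anti.
(* Scaling by 14 is a bijection of the positive reals, so the supremum is unchanged. *)
have a14_cvg : a (14 * e) @[e --> 0^'+] --> ereal_sup (a @` [set` `]0, +oo[]).
  have -> : a @` [set` `]0, +oo[] = (fun e => a (14 * e)) @` [set` `]0, +oo[].
    apply/seteqP; split=> _ [e + <-]; rewrite /= in_itv/= andbT => e0.
      exists (e / 14); last by rewrite mulrC divfK.
      by rewrite /= in_itv/= andbT divr_gt0.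
    by exists (14 * e) => //=; rewrite in_itv/= andbT mulr_gt0.
  apply: nonincreasing_at_right_cvge => // e e'; rewrite !in_itv/= !andbT => e0 _ ee'.
  by apply: a_anti; rewrite ?mulr_gt0// ler_pM2l.
(* [b e] lies between [a (14 * e)] and [a e], which have the same limit. *)
have b_cvg : b e @[e --> 0^'+] --> ereal_sup (a @` [set` `]0, +oo[]).
  apply: squeeze_cvge a14_cvg a_cvg; near=> e.
  have e0 : 0 < e by near: e; exact: nbhs_right_gt.
  by rewrite a_le_b// b_le_a.
have -> : htop d f = ereal_sup (a @` [set` `]0, +oo[]) by exact: (cvg_lim _ a_cvg).
by apply/esym; exact: (cvg_lim _ b_cvg).
Unshelve. all: by end_near.
Qed.
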